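(* There is a universal constant $C>0$ such that for every unit-weight graph $G$ on $n$ vertices there exists a binary signaling scheme that is persuasive and has cost at most $C\sqrt{n}\cdot\mathsf{OPT}$. Moreover, the $O(\sqrt{n})$ approximation ratio is tight for certain graphs: there is a universal constant $c>0$ and a family of unit-weight graphs with arbitrarily large number $n$ of vertices on which $\mathsf{OPT}=O(1)$ and every persuasive signaling scheme (with any finite signal space) has cost at least $c\sqrt{n}$.
   Context: Setting. $V$ is a finite set of $n$ task types and $W=(W_{u,v})_{u,v\in V}$ is a symmetric matrix with entries in $[0,1]$ and $W_{v,v}=1$ for all $v$. It is represented by the weighted graph $G=(V,E,w)$ with $E=\{\{u,v\}:u\neq v,\ W_{u,v}>0\}$ and $w(\{u,v\})=W_{u,v}$; $G$ is a unit-weight graph if all entries of $W$ lie in $\{0,1\}$. For $\theta\in\mathbb{R}_{\ge0}^V$ let $u_v(\theta)=\sum_{v'\in V}W_{v,v'}\theta_{v'}$. A vector $\theta\in\mathbb{R}_{\ge0}^V$ is feasible if $W\theta\ge\mathbf 1$ coordinatewise. $\mathsf{OPT}=\min\{\|\theta\|_1:\theta\ge 0 \text{ feasible}\}$. Signaling. There are $n$ agents; the type profile $t=(t_1,\dots,t_n)$ is a uniformly random bijection $[n]\to V$. A signaling scheme with finite signal space $\Sigma\subset[0,1]$ is a map $\varphi$ assigning to each bijection $t$ a distribution $\varphi(t)$ on $\Sigma^V$; given $t$, a vector $s=(s_v)_{v\in V}\sim\varphi(t)$ is drawn and agent $i$ privately receives $s_{t_i}$. For agent $i$, a signal $\theta\in\Sigma$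 with $\Pr[s_{t_i}=\theta]>0$ and $x\ge0$, let $Q_i(x\mid\theta)=\mathbb{E}\big[x+\sum_{v'\neq t_i}W_{t_i,v'}s_{v'}\,\big|\,s_{t_i}=\theta\big]$ (expectation over the joint law of $t$ and $s$). The scheme is persuasive if for every agent $i$ and every such $\theta$: $Q_i(\theta\mid\theta)\ge1$ and $\theta=\min\{x\ge0:Q_i(x\mid\theta)\ge1\}$. Its cost is $\mathbb{E}[\|s\|_1]$. A binary signaling scheme is one with $|\Sigma|=2$. *)

(* Defs.v *)
From HB Require Import structures.
From mathcomp Require Import all_boot all_order all_algebra.
From mathcomp Require Import classical_sets reals.
Set Implicit Arguments. Unset Strict Implicit. Unset Printing Implicit Defensive.
Import Order.TTheory GRing.Theory Num.Theory.
Local Open Scope ring_scope.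

Section Persuasion.
Variable R : realType.
Variable V : finType.

Definition unit_weight (W : V -> V -> R) : Prop :=
  (forall u v, W u v = W v u) /\ (forall v, W v v = 1) /\
  (forall u v, W u v = 0 \/ W u v = 1).

Definition feasible (W : V -> V -> R) (th : V -> R) : Prop :=
  (forall v, 0 <= th v) /\ (forall v, 1 <= \sum_(v' : V) W v v' * th v').

(* OPT = min { ||theta||_1 : theta feasible } (taken as an infimum; the LP
   minimum is attained). *)
Definition OPT (W : V -> V -> R) : R :=
  inf [set r : R | exists th : V -> R, feasible W th /\ r = \sum_(v : V) th v].

(* Type profiles: functions [n] -> V (n = #|V|); the random profile is uniform
   over the bijective ones. *)
Definition nprof : R :=
  #|[set t : {ffun 'I_#|V| -> V} | injectiveb t]|%:R.

(* Signal space: a finite set Sigma in [0,1], presented as the image of an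
   injective map sig : S -> R from a finite type S. *)
Definition signal_space (S : finType) (sig : S -> R) : Prop :=
  injective sig /\ (forall a, 0 <= sig a <= 1).

Definition is_scheme (S : finType)
    (phi : {ffun 'I_#|V| -> V} -> {ffun V -> S} -> R) : Prop :=
  forall t : {ffun 'I_#|V| -> V}, injectiveb t ->
    (forall s, 0 <= phi t s) /\ \sum_(s : {ffun V -> S}) phi t s = 1.

Definition Exp (S : finType)
    (phi : {ffun 'I_#|V| -> V} -> {ffun V -> S} -> R)
    (f : {ffun 'I_#|V| -> V} -> {ffun V -> S} -> R) : R :=
  \sum_(t : {ffun 'I_#|V| -> V} | injectiveb t)
    \sum_(s : {ffun V -> S}) (phi t s / nprof) * f t s.

Definition Pr_sig (S : finType) (sig : S -> R)
    (phi : {ffun 'I_#|V| -> V} -> {ffun V -> S} -> R)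
    (i : 'I_#|V|) (theta : R) : R :=
  Exp phi (fun t s => if sig (s (t i)) == theta then 1 else 0).

Definition Q (W : V -> V -> R) (S : finType) (sig : S -> R)
    (phi : {ffun 'I_#|V| -> V} -> {ffun V -> S} -> R)
    (i : 'I_#|V|) (x theta : R) : R :=
  Exp phi (fun t s =>
    (x + \sum_(v' : V | v' != t i) W (t i) v' * sig (s v'))
    * (if sig (s (t i)) == theta then 1 else 0))
  / Pr_sig sig phi i theta.

Definition persuasive (W : V -> V -> R) (S : finType) (sig : S -> R)
    (phi : {ffun 'I_#|V| -> V} -> {ffun V -> S} -> R) : Prop :=
  forall (i : 'I_#|V|) (theta : R), 0 < Pr_sig sig phi i theta ->
    1 <= Q W sig phi i theta theta /\
    ((0 <= theta /\ 1 <= Q W sig phi i theta theta) /\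
     (forall x, 0 <= x -> 1 <= Q W sig phi i x theta -> theta <= x)).

Definition cost (S : finType) (sig : S -> R)
    (phi : {ffun 'I_#|V| -> V} -> {ffun V -> S} -> R) : R :=
  Exp phi (fun t s => \sum_(v : V) `|sig (s v)|).

End Persuasion.

(* Main.v *)
(** Upper bound.  A scheme drawing a set [S] of vertices independently of the
profile, and sending [theta] on [S] and [0] elsewhere, is persuasive as soon as
[theta * E q(S) = E #|S|] and [n <= theta * E T(S)], where [q(S)] sums [W] over
[S * S] and [T(S)] sums it over [V * S].  A maximal independent set [A] satisfies
this with [theta = 1].  Let [x] be fractionally dominating of weight [K] and
suppose [#|A|] exceeds [4 sqrt n K].  Then [A] overcovers, [T(A) >= n + #|A| - K],
while the at most [K + 1] vertices of largest degree form a set [D] with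
[T(D) >= n].  Drawing [A] with probability [p = 4 sqrt n K / #|A|] and [D]
otherwise, the overcovering of [A] pays for the at most [(K + 1)^2] edges inside
[D], at expected size [O(sqrt n K)].

Lower bound.  Take two adjacent centers with [r ^ 2] leaves each.  If
the cost is small, the constraints summed over all signals force both centers to
receive nearly [1] almost always, so that each contributes an excess of about [1]
to the constraints of the signals that are at least [1 - 1/r].  Only leaves can
compensate it, each by at most [1/r], so that about [r] leaves must receive a
signal close to [1]. *)

Require Import Defs.
From HB Require Import structures.
From mathcomp Require Import all_boot all_order all_algebra.
From mathcomp Require Import classical_sets reals.
From mathcomp Require Import perm archimedean ring lra.
Set Implicit Arguments. Unset Strict Implicit. Unset Printing Implicit Defensive.
Import Order.TTheory GRing.Theory Num.Theory.
Local Open Scope ring_scope.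

(** * Uniformly random type profiles *)

Section Profiles.
Variables (R : realType) (V : finType).
Implicit Types (t : {ffun 'I_#|V| -> V}) (i : 'I_#|V|) (g : V -> R).

Lemma nprof_gt0 : 0 < nprof R V.
Proof.
rewrite /nprof ltr0n; apply/card_gt0P.
exists [ffun i => enum_val i]; rewrite inE; apply/injectiveP => i j.
by rewrite !ffunE => /enum_val_inj.
Qed.

Lemma nprofE : nprof R V = \sum_(t : {ffun 'I_#|V| -> V} | injectiveb t) 1.
Proof. by rewrite sumr_const /nprof cardsE. Qed.

Lemma sum_profile t g : injectiveb t -> \sum_i g (t i) = \sum_v g v.
Proof.
move=> /injectiveP t_inj; rewrite [RHS](reindex t) //.
by apply: onW_bij; apply: inj_card_bij => //; rewrite card_ord.
Qed.

(** Precomposing with the transposition of [i] and [j] permutes the bijections, so the sum is the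
    same for every agent. Averaging over agents then reduces to [sum_profile]. *)
Lemma sum_profile_agent i g :
  \sum_(t : {ffun 'I_#|V| -> V} | injectiveb t) g (t i)
    = nprof R V / #|V|%:R * \sum_v g v.
Proof.
pose swap j t : {ffun 'I_#|V| -> V} := [ffun k => t (tperm i j k)].
have swapK j : involutive (swap j) by move=> t; apply/ffunP=> k; rewrite !ffunE tpermK.
have swap_inj j t : injectiveb (swap j t) = injectiveb t.
  suff H t' : injectiveb t' -> injectiveb (swap j t').
    by apply/idP/idP; last exact: H; move/H; rewrite swapK.
  move=> /injectiveP t_inj; apply/injectiveP => k l.
  by rewrite !ffunE => /t_inj /perm_inj.
have sumE j : \sum_(t : {ffun 'I_#|V| -> V} | injectiveb t) g (t j)
              = \sum_(t : {ffun 'I_#|V| -> V} | injectiveb t) g (t i).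
  rewrite (reindex_inj (inv_inj (swapK j))).
  by apply: eq_big => [t|t _]; rewrite ?swap_inj // ffunE tpermR.
have n0 : #|V|%:R != 0 :> R by rewrite pnatr_eq0 -lt0n (leq_ltn_trans _ (ltn_ord i)).
apply: (mulfI n0); rewrite mulrA [_ * (_ / _)]mulrC divfK //.
rewrite -[X in X%:R * _ = _]card_ord mulr_natl -sumr_const.
rewrite (eq_bigr _ (fun j _ => esym (sumE j))).
rewrite exchange_big /= nprofE mulr_suml; apply: eq_bigr => t t_inj.
by rewrite mul1r; apply: sum_profile.
Qed.

End Profiles.

(** * Expectation over the profile and the signals *)

Section Expectation.
Variables (R : realType) (V S : finType).
Implicit Types (t : {ffun 'I_#|V| -> V}) (s : {ffun V -> S}).
Variable phi : {ffun 'I_#|V| -> V} -> {ffun V -> S} -> R.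
Implicit Types f g : {ffun 'I_#|V| -> V} -> {ffun V -> S} -> R.

Lemma eq_Exp f g : (forall t s, injectiveb t -> f t s = g t s) ->
  Exp phi f = Exp phi g.
Proof.
by move=> fg; apply: eq_bigr => t t_inj; apply: eq_bigr => s _; rewrite fg.
Qed.

Lemma ExpD f g : Exp phi (fun t s => f t s + g t s) = Exp phi f + Exp phi g.
Proof.
rewrite /Exp -big_split; apply: eq_bigr => t _ /=.
by rewrite -big_split; apply: eq_bigr => s _; rewrite mulrDr.
Qed.

Lemma ExpZ c f : Exp phi (fun t s => c * f t s) = c * Exp phi f.
Proof.
rewrite /Exp mulr_sumr; apply: eq_bigr => t _; rewrite mulr_sumr.
by apply: eq_bigr => s _; rewrite mulrCA.
Qed.

Lemma Exp_sum (I : finType) (f : I -> _ -> _ -> R) :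
  Exp phi (fun t s => \sum_i f i t s) = \sum_i Exp phi (f i).
Proof.
rewrite /Exp [RHS]exchange_big; apply: eq_bigr => t _ /=.
by rewrite [RHS]exchange_big; apply: eq_bigr => s _ /=; rewrite mulr_sumr.
Qed.

Hypothesis phiP : is_scheme phi.

Lemma scheme_weight_ge0 t s : injectiveb t -> 0 <= phi t s / nprof R V.
Proof.
by move=> /phiP[phi0 _]; rewrite divr_ge0 // ltW // nprof_gt0.
Qed.

Lemma Exp_cst c : Exp phi (fun _ _ => c) = c.
Proof.
rewrite /Exp; under eq_bigr => t t_inj
  do rewrite -mulr_suml -mulr_suml (phiP t_inj).2.
by rewrite -mulr_suml -mulr_suml -nprofE divff ?mul1r // lt0r_neq0 // nprof_gt0.
Qed.

Lemma le_Exp f g : (forall t s, injectiveb t -> f t s <= g t s) ->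
  Exp phi f <= Exp phi g.
Proof.
move=> fg; apply: ler_sum => t t_inj; apply: ler_sum => s _.
by apply: ler_wpM2l; [exact: scheme_weight_ge0 | exact: fg].
Qed.

Lemma Exp_null f g : (forall t s, 0 <= f t s) -> Exp phi f = 0 ->
  Exp phi (fun t s => g t s * f t s) = 0.
Proof.
move=> f0 Ef0; rewrite /Exp big1 // => t t_inj; rewrite big1 // => s _.
have w0 t' s' : injectiveb t' -> 0 <= phi t' s' / nprof R V * f t' s'.
  by move=> ?; rewrite mulr_ge0 ?scheme_weight_ge0.
rewrite mulrCA; suff -> : phi t s / nprof R V * f t s = 0 by rewrite mulr0.
have Et0 := psumr_eq0P (fun t' t'_inj => sumr_ge0 _ (fun s' _ => w0 t' s' t'_inj)) Ef0.
exact: (psumr_eq0P (fun s' _ => w0 t s' t_inj) (Et0 t t_inj)).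
Qed.

End Expectation.

(** * Persuasiveness as complementary slackness *)

Section Persuasiveness.
Variables (R : realType) (V S : finType) (W : V -> V -> R) (sig : S -> R).
Variable phi : {ffun 'I_#|V| -> V} -> {ffun V -> S} -> R.
Hypothesis W1 : forall v, W v v = 1.

Definition slack (s : {ffun V -> S}) v : R := \sum_u W v u * sig (s u) - 1.

(** An expectation over the event of receiving [theta], not conditioned on it: it stays meaningful
    for signals of probability zero and can be summed over signals. *)
Definition excess i theta : R :=
  Exp phi (fun t s => slack s (t i) * (if sig (s (t i)) == theta then 1 else 0)).

Lemma QE i x theta : 0 < Pr_sig sig phi i theta ->
  Q W sig phi i x theta = x - theta + 1 + excess i theta / Pr_sig sig phi i theta.
Proof.
move=> Pr0; rewrite /Q; apply: (mulIf (lt0r_neq0 Pr0)).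
rewrite divfK ?lt0r_neq0 // mulrDl divfK ?lt0r_neq0 // /Pr_sig -ExpZ -ExpD.
apply: eq_Exp => t s _; rewrite /slack [X in (X - 1) * _](bigD1 (t i)) //= W1.
by case: eqP => [->|_]; ring.
Qed.

(** By [QE], [Q] is affine in [x] with slope 1. A positive [theta] is thus minimal only if the
    constraint is tight, while at [theta = 0] nothing smaller is available and the inequality
    suffices. *)
Lemma persuasiveP : persuasive W sig phi <->
  forall i theta, 0 < Pr_sig sig phi i theta ->
    [/\ 0 <= theta, 0 <= excess i theta & 0 < theta -> excess i theta = 0].
Proof.
split=> H i theta Pr0; have QE0 x := QE x Pr0; move: (Pr0) (H i theta Pr0) QE0;
  move: (excess i theta) (Pr_sig sig phi i theta) => e P {H Pr0} Pr0 H QE0.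
- case: H => H1 [[th0 _] H2].
  have eP : 0 <= e / P by move: H1; rewrite QE0; lra.
  have e0 : 0 <= e by rewrite -(divfK (lt0r_neq0 Pr0) e) mulr_ge0 // ltW.
  split=> // th_gt0; apply/eqP; rewrite eq_le e0 andbT leNgt; apply/negP => e_gt0.
  have {}eP : 0 < e / P by rewrite divr_gt0.
  (* A strictly positive excess lets the agent lower [theta] by [e / P], or down to 0 if that would
     become negative. *)
  case: (leP (e / P) theta) => leth.
    by have := H2 (theta - e / P); rewrite QE0; lra.
  by have := H2 0; rewrite QE0; lra.
- case: H => th0 e0 He; have eP : 0 <= e / P by rewrite divr_ge0 // ltW.
  split; [by rewrite QE0; lra | split; [by split=> //; rewrite QE0; lra |]] => x x0.
  case: (ltrgt0P theta) th0 => // [th_gt0|-> //] _.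
  by rewrite QE0 (He th_gt0) mul0r; lra.
Qed.

Hypotheses (sigP : signal_space sig) (phiP : is_scheme phi).
Hypothesis pers : persuasive W sig phi.

Lemma excess_ge0 i a :
  0 <= excess i (sig a) /\ (0 < sig a -> excess i (sig a) = 0).
Proof.
have := (persuasiveP.1 pers) i (sig a).
have : 0 <= Pr_sig sig phi i (sig a).
  rewrite -[leLHS](Exp_cst phiP); apply: le_Exp => // t s _.
  by case: ifP => _; rewrite ?ler01.
rewrite le_eqVlt => /orP[/eqP Pr0 _|Pr0 /(_ Pr0) []//].
have -> : excess i (sig a) = 0; last by [].
apply: Exp_null => //; first by move=> t s; case: ifP.
Qed.

(** Along a bijection, the sum over vertices is a sum over agents; each agent's term is then sorted
    by the signal received, which is unique because [sig] is injective. *)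
Lemma weighted_slackE (g : R -> R) :
  Exp phi (fun _ s => \sum_v g (sig (s v)) * slack s v)
    = \sum_i \sum_a g (sig a) * excess i (sig a).
Proof.
under eq_bigr do under eq_bigr do rewrite -ExpZ.
under eq_bigr do rewrite -Exp_sum.
rewrite -Exp_sum; apply: eq_Exp => t s t_inj.
rewrite -(sum_profile _ t_inj); apply: eq_bigr => i _.
rewrite (bigD1 (s (t i))) //= eqxx mulr1 big1 ?addr0 // => a a_neq.
by rewrite (inj_eq sigP.1) eq_sym (negPf a_neq) !mulr0.
Qed.

Lemma weighted_slack_ge0 (g : R -> R) : (forall x, 0 <= g x) ->
  0 <= Exp phi (fun _ s => \sum_v g (sig (s v)) * slack s v).
Proof.
move=> g0; rewrite weighted_slackE; apply: sumr_ge0 => i _.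
by apply: sumr_ge0 => a _; rewrite mulr_ge0 // (excess_ge0 i a).1.
Qed.

Lemma weighted_slack_eq0 (g : R -> R) : g 0 = 0 ->
  Exp phi (fun _ s => \sum_v g (sig (s v)) * slack s v) = 0.
Proof.
move=> g0; rewrite weighted_slackE big1 // => i _; rewrite big1 // => a _.
have /andP[] := sigP.2 a; rewrite le_eqVlt => /orP[/eqP<-|a0] _.
  by rewrite g0 mul0r.
by rewrite (excess_ge0 i a).2 // mulr0.
Qed.

End Persuasiveness.

(** * The linear program and its near-optimal solutions *)

Section Optimum.
Variables (R : realType) (V : finType) (W : V -> V -> R).
Implicit Type th : V -> R.
Hypothesis W_unit : unit_weight W.

Let W1 v : W v v = 1. Proof. exact: W_unit.2.1. Qed.

Lemma weight_ge0 u v : 0 <= W u v.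
Proof. by have [->|->] := W_unit.2.2 u v; rewrite ?ler01. Qed.

Lemma weight_le1 u v : W u v <= 1.
Proof. by have [->|->] := W_unit.2.2 u v; rewrite ?ler01. Qed.

Lemma feasible_cst1 : feasible W (fun=> 1).
Proof.
split=> v; first exact: ler01.
rewrite (bigD1 v) //= W1 mulr1 lerDl; apply: sumr_ge0 => u _.
by rewrite mulr1 weight_ge0.
Qed.

Lemma OPT_le th : feasible W th -> OPT W <= \sum_v th v.
Proof.
move=> th_feas; apply: ge_inf; last by exists th.
by exists 0 => _ [x [[x0 _] ->]]; apply: sumr_ge0.
Qed.

Lemma feasible_sum_ge1 th (v : V) : feasible W th -> 1 <= \sum_u th u.
Proof.
move=> [th0 th1]; apply: le_trans (th1 v) _; apply: ler_sum => u _.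
by rewrite ler_piMl ?weight_le1.
Qed.

(** Capping a solution at 1 keeps it feasible for unit weights: a neighbor with value at least 1
    covers [v] alone after capping, and if there is none, nothing around [v] changes. *)
Lemma near_optimal : (0 < #|V|)%N -> exists x : V -> R,
  [/\ forall v, 0 <= x v <= 1, feasible W x & \sum_v x v <= 2 * OPT W].
Proof.
move=> /card_gt0P[v0 _]; rewrite /OPT; set E := (X in inf X).
have E0 : (E !=set0)%classic.
  by eexists; exists (fun=> 1); split=> //; exact: feasible_cst1.
have E1 : 1 <= inf E.
  by apply: lb_le_inf => // _ [th [th_feas ->]]; exact: feasible_sum_ge1.
have Einf : has_inf E.
  by split=> //; exists 1 => _ [th [th_feas ->]]; exact: feasible_sum_ge1.
(* The tolerance is [inf E] itself, positive by [E1]; hence the factor 2. *)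
have [_ [th [[th0 th1] ->]] lt2] := inf_adherent (lt_le_trans ltr01 E1) Einf.
exists (fun v => Num.min (th v) 1); split.
- by move=> v; rewrite le_min th0 ler01 ge_min lexx orbT.
- split=> v; first by rewrite le_min th0 ler01.
  have w0 u : 0 <= W v u * Num.min (th u) 1.
    by rewrite mulr_ge0 ?weight_ge0 // le_min th0 ler01.
  case: (pickP (fun u => (W v u == 1) && (1 <= th u))) => [u /andP[/eqP Wvu thu]|small].
    rewrite (bigD1 u) //= Wvu min_r // mulr1 lerDl; exact: sumr_ge0.
  apply: le_trans (th1 v) _; apply: ler_sum => u _.
  have [->|Wvu] := W_unit.2.2 v u; first by rewrite !mul0r.
  have /negbT := small u; rewrite Wvu eqxx /= -ltNge => /ltW ?.
  by rewrite min_l.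
- apply: (@le_trans _ _ (\sum_v th v)); last by apply: ltW; lra.
  by apply: ler_sum => v _; rewrite ge_min lexx.
Qed.

End Optimum.

(** * The lower bound on the double star *)

Definition double_star (L : nat) : finType := (bool + bool * 'I_L)%type.

(** Centers are [inl b], and [inr (b, l)] is a leaf of [inl b]. The relation is reflexive, which
    gives the unit diagonal of the weights. *)
Definition double_star_adj L (u v : double_star L) : bool :=
  match u, v with
  | inl _, inl _ => true
  | inl b, inr (b', _) | inr (b', _), inl b => b == b'
  | inr l, inr l' => l == l'
  end.

Section DoubleStar.
Variables (R : realType) (L : nat).
Local Notation V := (double_star L).
Implicit Types x : V -> R.

Definition double_star_weight (u v : V) : R := (double_star_adj u v)%:R.
Local Notation W := double_star_weight.

Lemma double_star_unit : unit_weight W.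
Proof.
split; last split.
- by move=> [b|[b l]] [b'|[b' l']] //; rewrite /W /= eq_sym.
- by move=> [b|[b l]]; rewrite /W /= ?eqxx.
- by move=> u v; rewrite /W; case: double_star_adj; [right|left].
Qed.

Lemma sum_double_star x :
  \sum_v x v = x (inl true) + x (inl false)
    + (\sum_l x (inr (true, l)) + \sum_l x (inr (false, l))).
Proof.
rewrite big_sumType big_bool /=; congr (_ + _).
transitivity (\sum_b \sum_l x (inr (b, l))); last by rewrite big_bool.
by rewrite pair_bigA; apply: eq_bigr => -[].
Qed.

Lemma double_star_center x b : \sum_u W (inl b) u * x u
  = x (inl true) + x (inl false) + \sum_l x (inr (b, l)).
Proof.
rewrite sum_double_star /W /= -!mulr_sumr.
by case: b; rewrite /= !mul1r !mul0r ?addr0 ?add0r.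
Qed.

Lemma double_star_leaf x b l : \sum_u W (inr (b, l)) u * x u
  = x (inl b) + x (inr (b, l)).
Proof.
rewrite sum_double_star /W /=.
have sum_leaf b' : \sum_l' ((b, l) == (b', l'))%:R * x (inr (b', l'))
                   = (b == b')%:R * x (inr (b, l)).
  rewrite (bigD1 l) //= big1 ?addr0 => [|l' l'l].
    by rewrite xpair_eqE eqxx andbT; case: eqP => [->|] //; rewrite !mul0r.
  by rewrite xpair_eqE [l == l']eq_sym (negPf l'l) andbF mul0r.
by rewrite !sum_leaf; case: b {sum_leaf}; rewrite /= !mul1r !mul0r ?addr0 ?add0r.
Qed.

Lemma double_star_OPT : OPT W <= 2.
Proof.
pose th (v : V) : R := if v is inl _ then 1 else 0.
apply: le_trans (OPT_le (th := th) _) _.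
  split=> [[]|[b|[b l]]] /=; rewrite ?ler01 //.
    by rewrite double_star_center /= big1 // addr0 lerDl ler01.
  by rewrite double_star_leaf /= addr0.
by rewrite sum_double_star /= !big1 // !addr0.
Qed.

(** With both centers above the threshold the right side is at least [2 - 2 * D], where
    [D = 2 - (c + c')]. A center below it forces [e <= D], so that the penalty [2 * D / e] is at
    least 2 and absorbs the main term. *)
Lemma center_excess (g : R -> R) e c c' Y Y' :
  (g = fun z => if 1 - e <= z then 1 else 0) -> 0 < e <= 1 ->
  0 <= c <= 1 -> 0 <= c' <= 1 -> 0 <= Y -> 0 <= Y' ->
  2 - 2 * e - 2 / e * (2 - (c + c'))
    <= g c * (c + c' + Y - 1) + g c' * (c + c' + Y' - 1).
Proof.
move=> -> /andP[e0 e1] /andP[c0 c1] /andP[c'0 c'1] Y0 Y'0.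
have -> : 2 / e * (2 - (c + c')) = 2 * ((2 - (c + c')) / e) by ring.
set D := 2 - (c + c').
have leD : D <= D / e.
  by rewrite ler_pdivlMr // ler_piMr // /D; lra.
have ltD : e <= D -> 1 <= D / e by move=> ?; rewrite ler_pdivlMr // mul1r.
move: leD ltD; rewrite /D; move: (_ / e) => De leD ltD.
case: (leP (1 - e) c) => hc; case: (leP (1 - e) c') => hc';
  rewrite ?mul1r ?mul0r;
  by [lra | have := ltD ltac:(lra); lra].
Qed.

(** A leaf above the threshold has shortfall at most [e], and [1 / 2 <= y] turns this into
    [2 * e * y], which can be charged to the cost. *)
Lemma leaf_excess (g : R -> R) e c y :
  (g = fun z => if 1 - e <= z then 1 else 0) -> 0 < e <= 1 / 2 ->
  0 <= c -> 0 <= y -> - (2 * e) * y <= g y * (c + y - 1).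
Proof.
move=> -> /andP[e0 e1] c0 y0.
case: (leP (1 - e) y) => hy; rewrite ?mul1r ?mul0r; last first.
  by rewrite mulNr oppr_le0 mulr_ge0 // mulr_ge0 // ltW.
have : e <= 2 * e * y by rewrite mulrAC ler_peMl //; lra.
by lra.
Qed.

(* In expectation the first sum is nonnegative and the last one vanishes, and
   [k] is such that the deficit of the centers cancels. *)
Lemma double_star_excess (r : nat) (g : R -> R) (k : R) x :
  (6 <= r)%N -> L = (r * r)%N -> (forall v, 0 <= x v <= 1) ->
  k = 2 * r%:R / (L%:R + 2) ->
  (g = fun z => if 1 - r%:R^-1 <= z then 1 else 0) ->
  k * \sum_v (\sum_u W v u * x u - 1) + 1 - 6 / r%:R * \sum_v x v
    <= \sum_v g (x v) * (\sum_u W v u * x u - 1).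
Proof.
move=> r6 LE x01 kE gE.
have r6R : 6 <= r%:R :> R by rewrite ler_nat.
have r0 : 0 < r%:R :> R by lra.
have LR : L%:R = r%:R * r%:R :> R by rewrite LE natrM.
have e0 : 0 < r%:R^-1 :> R by rewrite invr_gt0.
have e6 : r%:R^-1 <= 1 / 6 :> R by rewrite div1r lef_pV2 ?posrE.
have L0 : 0 < L%:R :> R by rewrite LR mulr_gt0.
have kL : k * (L%:R + 2) = 2 / r%:R^-1.
  by rewrite kE invrK divfK // lt0r_neq0 //; lra.
have k2 : k <= 2 * r%:R^-1.
  rewrite kE ler_pdivrMr; last lra.
  rewrite LR mulrDr -mulrA [_^-1 * (_ * _)]mulrA mulVf ?lt0r_neq0 // mul1r.
  by rewrite lerDl !mulr_ge0 ?invr_ge0 // ltW.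
move: (r%:R^-1) e0 e6 kL k2 gE => e e0 e6 kL k2 gE.
have x0 v : 0 <= x v by case/andP: (x01 v).
pose c b := x (inl b); pose Y b := \sum_l x (inr (b, l)).
have Y0 b : 0 <= Y b by exact: sumr_ge0.
have sum_leaf b : \sum_l (c b + x (inr (b, l)) - 1) = L%:R * (c b - 1) + Y b.
  under eq_bigr do rewrite addrAC.
  by rewrite big_split sumr_const card_ord mulr_natl.
have leaves b :
  - (2 * e) * Y b <= \sum_l g (x (inr (b, l))) * (c b + x (inr (b, l)) - 1).
  rewrite mulr_sumr; apply: ler_sum => l _.
  by apply: leaf_excess => //; [rewrite e0; lra | exact: x0].
have e1 : 0 < e <= 1 by rewrite e0; lra.
have := center_excess gE e1 (x01 (inl true)) (x01 (inl false)) (Y0 true) (Y0 false).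
move: (leaves true) (leaves false).
rewrite !(sum_double_star (fun v => \sum_u _ - 1)) (sum_double_star x).
rewrite (sum_double_star (fun v => g (x v) * _)) !double_star_center.
have leafE b : \sum_l (\sum_u W (inr (b, l)) u * x u - 1) = L%:R * (c b - 1) + Y b.
  by rewrite -sum_leaf; apply: eq_bigr => l _; rewrite double_star_leaf.
have gleafE b : \sum_l g (x (inr (b, l))) * (\sum_u W (inr (b, l)) u * x u - 1)
  = \sum_l g (x (inr (b, l))) * (c b + x (inr (b, l)) - 1).
  by apply: eq_bigr => l _; rewrite double_star_leaf.
rewrite !leafE !gleafE -/(Y true) -/(Y false) -/(c true) -/(c false).
set A := \sum_l _; set B := \sum_l _ => hA hB hC.
have := Y0 true; have := Y0 false; have := x0 (inl true); have := x0 (inl false).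
rewrite -/(c true) -/(c false); move: (c true) (c false) (Y true) (Y false) A B hA hB hC.
move=> c1 c2 Y1 Y2 A B hA hB hC c20 c10 Y20 Y10.
have kF : k * (c1 + c2 + Y1 - 1 + (c1 + c2 + Y2 - 1)
    + (L%:R * (c1 - 1) + Y1 + (L%:R * (c2 - 1) + Y2)))
  = k * (2 + 2 * (Y1 + Y2)) - 2 / e * (2 - (c1 + c2)).
  by rewrite -kL; ring.
(* The leaf mass is charged [4 * e] here and [2 * e] in [leaves], whence the 6 of the statement; the
   constants need [6 * e <= 1], that is [6 <= r]. *)
have kY : k * (2 + 2 * (Y1 + Y2)) <= 2 * e * (2 + 2 * (Y1 + Y2)).
  by apply: ler_wpM2r => //; lra.
have ec : 0 <= e * (c1 + c2) by rewrite mulr_ge0 //; lra.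
rewrite kF; move: (2 / e * _) hC kY => z hC kY. 
by lra.
Qed.

Lemma double_star_cost (r : nat) (S : finType) (sig : S -> R)
    (phi : {ffun 'I_#|V| -> V} -> {ffun V -> S} -> R) :
  (6 <= r)%N -> L = (r * r)%N ->
  signal_space sig -> is_scheme phi -> persuasive W sig phi ->
  r%:R / 6 <= cost sig phi.
Proof.
move=> r6 LE sigP phiP pers.
have [_ [W1 _]] := double_star_unit.
have r6R : 6 <= r%:R :> R by rewrite ler_nat.
pose g (z : R) : R := if 1 - r%:R^-1 <= z then 1 else 0.
pose k : R := 2 * r%:R / (L%:R + 2).
have k0 : 0 <= k by rewrite divr_ge0 ?mulr_ge0 ?addr_ge0 ?ler0n.
have g0 : g 0 = 0.
  by rewrite /g ifN // -ltNge subr_gt0 invf_lt1; lra.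
(* The constant weight also counts the signal 0, where only an inequality holds; the threshold
   weight vanishes at 0 and yields the equality [E2]. *)
have E1 := weighted_slack_ge0 W1 sigP phiP pers (g := fun=> 1) (fun=> ler01).
have E2 := weighted_slack_eq0 W1 sigP phiP pers g0.
have costE : Exp phi (fun _ s => \sum_v sig (s v)) = cost sig phi.
  apply: eq_Exp => t s _; apply: eq_bigr => v _.
  by rewrite ger0_norm //; case/andP: (sigP.2 (s v)).
suff : k * Exp phi (fun _ s => \sum_v 1 * slack W sig s v) + 1
       - 6 / r%:R * cost sig phi <= 0.
  move=> h; have {E1} := mulr_ge0 k0 E1; move: (k * _) h => z h z0.
  rewrite ler_pdivrMr // -[leLHS]mul1r -ler_pdivlMr; last lra.
  by rewrite -mulrA mulrC; lra.
pose h (s : {ffun V -> S}) := k * (\sum_v 1 * slack W sig s v)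
  + (1 + - (6 / r%:R) * \sum_v sig (s v)).
have <- : Exp phi (fun _ s => h s)
  = k * Exp phi (fun _ s => \sum_v 1 * slack W sig s v) + 1
    - 6 / r%:R * cost sig phi.
  by rewrite ExpD ExpD !ExpZ Exp_cst // costE mulNr addrA.
rewrite -[leRHS]E2; apply: le_Exp => // t s _; rewrite /h mulNr addrA.
under [X in k * X]eq_bigr do rewrite mul1r.
exact: (double_star_excess r6 LE (fun v => sigP.2 (s v)) (erefl k) (erefl g)).
Qed.

End DoubleStar.

(** * Binary schemes that ignore the profile *)

Section BinaryScheme.
Variables (R : realType) (V : finType) (W : V -> V -> R).
Hypothesis W1 : forall v, W v v = 1.
Implicit Types (s : {ffun V -> bool}) (A : {set V}).

Definition reach s : R := \sum_v \sum_u W v u * (s u)%:R.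
Definition inner s : R := \sum_v (s v)%:R * \sum_u W v u * (s u)%:R.

Section Law.
Variables (mu : {ffun V -> bool} -> R) (theta : R).
Hypotheses (mu0 : forall s, 0 <= mu s) (mu1 : \sum_s mu s = 1).
Hypothesis theta01 : 0 < theta <= 1.
Local Notation E f := (\sum_s mu s * f s).
Hypothesis inner_eq : theta * E inner = E (fun s => \sum_v (s v)%:R).
Hypothesis reach_ge : #|V|%:R <= theta * E reach.

Definition two_signals (b : bool) : R := if b then theta else 0.
Definition blind_scheme (_ : {ffun 'I_#|V| -> V}) s : R := mu s.

Let theta0 : 0 < theta. Proof. by case/andP: theta01. Qed.

Lemma two_signalsP : signal_space two_signals.
Proof.
split=> [[] [] //= /eqP|[]] /=; rewrite ?lexx ?ler01 //.
- by rewrite gt_eqF.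
- by rewrite lt_eqF.
- by case/andP: theta01 => /ltW ->.
Qed.

Lemma two_signalsE b : two_signals b = theta * b%:R.
Proof. by case: b; rewrite /= ?mulr1 ?mulr0. Qed.

Lemma blind_schemeP : is_scheme blind_scheme.
Proof. by []. Qed.

Lemma Exp_blind i (h : {ffun V -> bool} -> V -> R) :
  Exp blind_scheme (fun t s => h s (t i)) = #|V|%:R^-1 * E (fun s => \sum_v h s v).
Proof.
rewrite /Exp /blind_scheme exchange_big mulr_sumr; apply: eq_bigr => s _ /=.
rewrite -mulr_sumr sum_profile_agent; move: (#|V|%:R^-1) => k.
by field; rewrite lt0r_neq0 ?nprof_gt0.
Qed.

(** An agent's type is uniform and independent of [s], so the excess at a signal is the mean slack,
    divided by the number of vertices, over those receiving it. This vanishes on the chosen set by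
    [inner_eq]; hence all of the total slack, nonnegative by [reach_ge], lies outside it. *)
Lemma blind_persuasive : persuasive W two_signals blind_scheme.
Proof.
apply/(persuasiveP two_signals blind_scheme W1) => i th Pr0.
(* Any value other than [theta] and 0 has probability zero, against [Pr0]. *)
have [b ->] : exists b, th = two_signals b.
  have [->|th1] := eqVneq th theta; first by exists true.
  have [->|th0] := eqVneq th 0; first by exists false.
  suff E0 : Pr_sig two_signals blind_scheme i th = 0 by rewrite E0 ltxx in Pr0.
  rewrite -[RHS](Exp_cst blind_schemeP); apply: eq_Exp => t s _.
  by rewrite eq_sym; case: (s _); rewrite ?(negPf th1) ?(negPf th0).
have -> : excess W two_signals blind_scheme i (two_signals b)
  = #|V|%:R^-1 * E (fun s => \sum_v slack W two_signals s v * (s v == b)%:R).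
  rewrite -(Exp_blind i (fun s v => slack W two_signals s v * (s v == b)%:R)).
  apply: eq_Exp => t s _; rewrite (inj_eq two_signalsP.1).
  by case: eqP.
have slackE s v : slack W two_signals s v = theta * (\sum_u W v u * (s u)%:R) - 1.
  rewrite /slack mulr_sumr; congr (_ - 1); apply: eq_bigr => u _.
  by rewrite two_signalsE mulrCA.
have E1 : E (fun s => \sum_v slack W two_signals s v * (s v)%:R) = 0.
  transitivity (theta * E inner - E (fun s => \sum_v (s v)%:R)); last first.
    by rewrite inner_eq subrr.
  rewrite mulr_sumr -sumrB; apply: eq_bigr => s _.
  rewrite mulrCA -mulrBr; congr (_ * _); rewrite mulr_sumr -sumrB.
  by apply: eq_bigr => v _; rewrite slackE; ring.
have E2 : E (fun s => \sum_v slack W two_signals s v) = theta * E reach - #|V|%:R.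
  have -> : #|V|%:R = \sum_s mu s * #|V|%:R by rewrite -mulr_suml mu1 mul1r.
  rewrite mulr_sumr -sumrB; apply: eq_bigr => s _.
  rewrite mulrCA -mulrBr; congr (_ * _); rewrite mulr_sumr -sumr_const -sumrB.
  by apply: eq_bigr => v _; rewrite slackE.
case: b => /=.
- have -> : E (fun s => \sum_v slack W two_signals s v * (s v == true)%:R) = 0.
    rewrite -[RHS]E1; apply: eq_bigr => s _; congr (_ * _).
    by apply: eq_bigr => v _; rewrite eqb_id.
  by rewrite mulr0; split=> //; exact: ltW.
- have -> : E (fun s => \sum_v slack W two_signals s v * (s v == false)%:R)
    = theta * E reach - #|V|%:R.
    rewrite -E2 -[RHS]subr0 -[X in _ = _ - X]E1 -sumrB; apply: eq_bigr => s _.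
    rewrite -mulrBr -sumrB; congr (_ * _); apply: eq_bigr => v _.
    by case: (s v); rewrite /= ?mulr1 ?mulr0 ?subrr ?subr0.
  by rewrite ltxx; split=> //; rewrite mulr_ge0 ?invr_ge0 ?ler0n // subr_ge0.
Qed.

Lemma cost_blind : cost two_signals blind_scheme = theta * E (fun s => \sum_v (s v)%:R).
Proof.
rewrite /cost /Exp /blind_scheme exchange_big mulr_sumr; apply: eq_bigr => s _ /=.
have -> : \sum_v `|two_signals (s v)| = theta * \sum_v (s v)%:R.
  rewrite mulr_sumr; apply: eq_bigr => v _; rewrite two_signalsE ger0_norm //.
  by rewrite mulr_ge0 ?ler0n // ltW.
set c := _ * (theta * _).
rewrite (eq_bigr (fun=> 1 * c)) => [|t _]; last by rewrite mul1r.
rewrite -mulr_suml -nprofE /c; field; exact: lt0r_neq0 (nprof_gt0 R V).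
Qed.

End Law.

Definition indic A : {ffun V -> bool} := [ffun v => v \in A].

Lemma sum_indic A (f : V -> R) : \sum_v f v * (indic A v)%:R = \sum_(v in A) f v.
Proof.
rewrite [RHS]big_mkcond; apply: eq_bigr => v _.
by rewrite ffunE; case: ifP; rewrite ?mulr1 ?mulr0.
Qed.

Definition set_reach A : R := \sum_v \sum_(u in A) W v u.
Definition set_inner A : R := \sum_(v in A) \sum_(u in A) W v u.

Lemma reach_indic A : reach (indic A) = set_reach A.
Proof. by apply: eq_bigr => v _; rewrite sum_indic. Qed.

Lemma inner_indic A : inner (indic A) = set_inner A.
Proof.
rewrite /set_inner -sum_indic; apply: eq_bigr => v _.
by rewrite sum_indic mulrC.
Qed.

Lemma card_indic A : \sum_v (indic A v)%:R = #|A|%:R :> R.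
Proof.
by rewrite -sum1_card natr_sum -sum_indic; apply: eq_bigr => v _; rewrite mul1r.
Qed.

Lemma set_inner_ge A : (forall u v, 0 <= W u v) -> #|A|%:R <= set_inner A.
Proof.
move=> W0; rewrite -sum1_card natr_sum; apply: ler_sum => v vA.
by rewrite (bigD1 v) //= W1 lerDl sumr_ge0.
Qed.

Lemma two_set_scheme (p theta m q : R) (A B : {set V}) :
  0 <= p <= 1 -> 0 < theta <= 1 ->
  m = p * #|A|%:R + (1 - p) * #|B|%:R ->
  q = p * set_inner A + (1 - p) * set_inner B ->
  theta * q = m ->
  #|V|%:R <= theta * (p * set_reach A + (1 - p) * set_reach B) ->
  exists (S : finType) (sig : S -> R)
         (phi : {ffun 'I_#|V| -> V} -> {ffun V -> S} -> R),
    #|S| = 2%N /\ signal_space sig /\ is_scheme phi /\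
    persuasive W sig phi /\ cost sig phi <= m.
Proof.
move=> /andP[p0 p1] theta01 mE qE theta_m le_reach.
have q0 : 0 <= 1 - p by lra.
(* Adding the two point masses also covers [A = B]. *)
pose mu (s : {ffun V -> bool}) : R :=
  p * (s == indic A)%:R + (1 - p) * (s == indic B)%:R.
have mu0 s : 0 <= mu s by rewrite addr_ge0 // mulr_ge0.
have Emu f : \sum_s mu s * f s = p * f (indic A) + (1 - p) * f (indic B).
  have sum1 A' : \sum_s (s == indic A')%:R * f s = f (indic A').
    rewrite (bigD1 (indic A')) //= eqxx mul1r big1 ?addr0 // => s sA'.
    by rewrite (negPf sA') mul0r.
  rewrite -(sum1 A) -(sum1 B) !mulr_sumr -big_split.
  by apply: eq_bigr => s _; rewrite /mu /=; ring.
have mu1 : \sum_s mu s = 1.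
  rewrite (eq_bigr (fun s => mu s * 1)) => [|s _]; last by rewrite mulr1.
  by rewrite (Emu (fun=> 1)); ring.
exists bool, (two_signals theta), (blind_scheme mu).
split; first exact: card_bool.
split; first exact: two_signalsP.
split; first exact: blind_schemeP.
have Em : \sum_s mu s * (\sum_v (s v)%:R) = m by rewrite mE Emu !card_indic.
split.
  by apply: blind_persuasive; rewrite ?Em // Emu ?inner_indic ?reach_indic -?qE.
rewrite cost_blind // Em; case/andP: theta01 => _ ?; rewrite ler_piMl // mE.
by rewrite addr_ge0 // mulr_ge0.
Qed.

End BinaryScheme.

(** Among the sets of at most [m] elements, take one maximizing the sum of [f]. It is either
    everything or, by exchange, consists of the [m] largest values, which dominate any fractional
    choice of weight at most [m]. *)
Lemma fractional_knapsack (R : realType) (V : finType) (f x : V -> R) :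
  (forall v, 0 < f v) -> (forall v, 0 <= x v <= 1) ->
  exists D : {set V}, #|D|%:R <= \sum_v x v + 1 /\
    \sum_v x v * f v <= \sum_(v in D) f v.
Proof.
move=> f0 x01; set K := \sum_v x v.
have K0 : 0 <= K by apply: sumr_ge0 => v _; case/andP: (x01 v).
pose m := (Num.truncn K).+1.
have [Km mK] : K <= m%:R /\ m%:R <= K + 1.
  have /andP[leK ltK] := truncn_itv K0.
  by split; [exact: ltW | rewrite /m -natr1 lerD2r].
have P0 : (#|(finset.set0 : {set V})| <= m)%N by rewrite cards0.
case: (@Order.TotalTheory.arg_maxP _ R _ finset.set0 (fun D : {set V} => (#|D| <= m)%N)
  (fun D => \sum_(v in D) f v) P0) => D Dm Dmax.
exists D; split; first by apply: le_trans mK; rewrite ler_nat.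
have sumD (h : V -> R) : \sum_(v in D) h v = \sum_v (v \in D)%:R * h v.
  by rewrite big_mkcond; apply: eq_bigr => v _; case: ifP; rewrite ?mul1r ?mul0r.
(* If [D] has room left, it is all of [V], since [f] is positive and any further element would
   improve it. *)
have [ltDm|] := ltnP #|D| m.
  rewrite sumD; apply: ler_sum => v _.
  suff -> : v \in D by rewrite ler_wpM2r ?(ltW (f0 v)) //; case/andP: (x01 v).
  apply/negPn/negP => vD; have := Dmax (v |: D).
  by rewrite cardsU1 vD add1n big_setU1 //= gerDr leNgt f0 => /(_ ltDm).
move=> leDm; have {leDm Dm}Dm : #|D| = m by apply/eqP; rewrite eqn_leq Dm.
have [u0 u0D] : exists u, u \in D by apply/finset.set0Pn; rewrite -card_gt0 Dm.
case: (@Order.TotalTheory.arg_minP _ R _ u0 (mem D) f u0D) => u uD umin.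
have {}uD : u \in D := uD.
have outside w : w \notin D -> f w <= f u.
  move=> wD; have := Dmax (w |: (D :\ u)).
  have wDu : w \notin D :\ u by rewrite in_setD1 (negPf wD) andbF.
  rewrite cardsU1 wDu add1n -Dm [X in (_ <= X)%N](cardsD1 u) uD add1n leqnn.
  by rewrite big_setU1 //= [leRHS](big_setD1 u) //= lerD2r => /(_ isT).
(* Shifting by [f u], the least value on [D], makes the terms nonnegative on [D] and nonpositive
   outside, so the comparison is termwise. *)
have Kf : \sum_v x v * (f v - f u) <= \sum_(v in D) (f v - f u).
  rewrite sumD; apply: ler_sum => v _; have /andP[x0 x1] := x01 v.
  case: (boolP (v \in D)) => [vD|/outside vD]; rewrite ?mul1r ?mul0r.
    by rewrite ler_piMl // subr_ge0; exact: umin.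
  by rewrite mulr_ge0_le0 // subr_le0.
have Dfu : \sum_(v in D) (f v - f u) = \sum_(v in D) f v - m%:R * f u.
  by rewrite sumrB sumr_const Dm mulr_natl.
have Kfu : \sum_v x v * (f v - f u) = \sum_v x v * f v - K * f u.
  by rewrite mulr_suml -sumrB; apply: eq_bigr => v _; rewrite mulrBr.
rewrite Dfu Kfu in Kf.
have : K * f u <= m%:R * f u by rewrite ler_wpM2r // ltW.
by lra.
Qed.

(** * Maximal independent sets *)

Section MaximalIndependent.
Variables (R : realType) (V : finType) (W : V -> V -> R).
Hypothesis W_unit : unit_weight W.

Definition independent (A : {set V}) : bool :=
  [forall u in A, forall v in A, (u != v) ==> (W u v == 0)].

Lemma independentP (A : {set V}) :
  reflect {in A &, forall u v, u != v -> W u v = 0} (independent A).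
Proof.
apply: (iffP forall_inP) => [h u v uA vA uv|h u uA].
  by have /forall_inP/(_ v vA)/implyP/(_ uv)/eqP := h u uA.
by apply/forall_inP => v vA; apply/implyP => uv; rewrite h.
Qed.

(** A vertex with no neighbor in [A] could be added to [A], so a maximal independent set dominates;
    by independence only the diagonal contributes to [set_inner]. *)
Lemma maximal_independent : exists A : {set V},
  set_inner W A = #|A|%:R /\ forall v, 1 <= \sum_(u in A) W v u.
Proof.
have [Wsym [W1 W01]] := W_unit; have W0 := weight_ge0 W_unit.
have ind0 : independent finset.set0 by apply/independentP => u v; rewrite inE.
have [A Amax _] := maxset_exists ind0; have Aind := maxsetp Amax.
have cov v : 1 <= \sum_(u in A) W v u.
  have [u /andP[uA Wvu]|nadj] := pickP (fun u => (u \in A) && (W v u != 0)).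
    rewrite (bigD1 u) //=; have [Wvu0|->] := W01 v u; first by rewrite Wvu0 eqxx in Wvu.
    by rewrite lerDl sumr_ge0.
  have {}nadj u : u \in A -> W v u = 0.
    by move=> uA; have := nadj u; rewrite uA /= => /negbFE/eqP.
  have vA : v \in A.
    have <- : v |: A = A; last by rewrite setU11.
    apply: (maxsetsup Amax); last exact: subsetU1.
    apply/independentP => u w; rewrite !in_setU1.
    case/orP=> [/eqP->|uA]; case/orP=> [/eqP->|wA]; rewrite ?eqxx // => uw.
    - exact: nadj.
    - by rewrite Wsym nadj.
    - by apply: (independentP _ Aind).
  by have := W1 v; rewrite (nadj v vA) => /eqP; rewrite eq_sym oner_eq0.
exists A; split=> //.
rewrite -sum1_card natr_sum; apply: eq_bigr => v vA.
rewrite (bigD1 v) //= W1 big1 ?addr0 // => u /andP[uA uv].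
by apply: (independentP _ Aind) => //; rewrite eq_sym.
Qed.

End MaximalIndependent.

(** * The upper bound *)

Lemma sqrt_scheme (R : realType) (V : finType) (W : V -> V -> R) :
  unit_weight W ->
  exists (S : finType) (sig : S -> R)
         (phi : {ffun 'I_#|V| -> V} -> {ffun V -> S} -> R),
    #|S| = 2%N /\ signal_space sig /\ is_scheme phi /\
    persuasive W sig phi /\ cost sig phi <= 12 * Num.sqrt (#|V|%:R) * OPT W.
Proof.
move=> W_unit; have [_ [W1 _]] := W_unit.
have W0 := weight_ge0 W_unit; have Wle1 := weight_le1 W_unit.
have [A [innA covA]] := maximal_independent W_unit.
set n := #|V|%:R; set s := Num.sqrt n; set a : R := #|A|%:R.
(* Always drawing [A] with signal 1 settles every case in which [A] is small enough. *)
have schemeA c : a <= c -> exists (S : finType) (sig : S -> R)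
    (phi : {ffun 'I_#|V| -> V} -> {ffun V -> S} -> R),
    #|S| = 2%N /\ signal_space sig /\ is_scheme phi /\
    persuasive W sig phi /\ cost sig phi <= c.
  move=> ac.
  have [] := @two_set_scheme _ _ _ W1 1 1 a a A A;
    rewrite ?ler01 ?ltr01 ?innA ?mul1r ?subrr ?mul0r ?addr0 ?lexx //.
    by rewrite -sum1_card natr_sum; apply: ler_sum.
  move=> S [sig [phi [S2 [sigP [phiP [pers le_cost]]]]]].
  by exists S, sig, phi; do 4!split=> //; exact: le_trans ac.
have [V0|V0] := posnP #|V|.
  apply: schemeA; rewrite /s /n V0 sqrtr0 mulr0 mul0r /a.
  suff /eqP-> : #|A| == 0%N by [].
  by rewrite -leqn0 -V0 max_card.
have [x [x01 x_feas K_OPT]] := near_optimal W_unit V0.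
have /card_gt0P[v0 _] := V0.
have K1 := feasible_sum_ge1 W_unit v0 x_feas.
move: K_OPT K1; set K := \sum_v x v => K_OPT K1.
have n1 : 1 <= n by rewrite ler1n.
have s2 : s * s = n by rewrite -expr2 sqr_sqrtr // ler0n.
have s1 : 1 <= s by rewrite -sqrtr1 ler_sqrt //; lra.
have sK : s <= s * K by rewrite ler_peMr //; lra.
have sKK : K <= s * K by rewrite ler_peMl //; lra.
have sOPT : s * K <= 2 * (s * OPT W) by rewrite mulrCA ler_wpM2l //; lra.
have [a_le|a_gt] := leP a (4 * (s * K)); first by apply: schemeA; lra.
have W_sum_gt0 u : 0 < \sum_v W v u.
  by rewrite (bigD1 u) //= W1 ltr_wpDr ?ltr01 // sumr_ge0.
have [D [D_card]] := fractional_knapsack W_sum_gt0 x01.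
move=> D_max; pose k : R := #|D|%:R.
have {}D_card : k <= K + 1 := D_card.
have reachA : n + (a - K) <= set_reach W A.
  have -> : n = \sum_(v : V) 1 by rewrite sumr_const.
  rewrite -lerBrDl -sumrB.
  have le_xA : \sum_v x v * (\sum_(u in A) W v u - 1)
    <= \sum_v (\sum_(u in A) W v u - 1).
    by apply: ler_sum => v _; rewrite ler_piMl ?subr_ge0 //; case/andP: (x01 v).
  apply: le_trans le_xA; under eq_bigr do rewrite mulrBr mulr1.
  rewrite sumrB -/K lerD2r /a -sum1_card natr_sum.
  under [leRHS]eq_bigr do rewrite mulr_sumr.
  rewrite exchange_big; apply: ler_sum => u _ /=.
  apply: le_trans (x_feas.2 u) _; apply: ler_sum => v _.
  by rewrite W_unit.1 mulrC.
(* Summing the constraints of [x] shows that the degrees weighted by [x] total at least [n]; [D]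
   does no worse by its choice. *)
have reachD : n <= set_reach W D.
  rewrite /set_reach exchange_big; apply: le_trans D_max.
  under eq_bigr do rewrite mulr_sumr.
  rewrite exchange_big /n -sum1_card natr_sum; apply: ler_sum => v _ /=.
  by apply: le_trans (x_feas.2 v) _; apply: ler_sum => u _; rewrite mulrC.
have innD : set_inner W D <= k * k.
  have -> : k * k = \sum_(v in D) k by rewrite sumr_const mulr_natl.
  by apply: ler_sum => v _; rewrite /k -sum1_card natr_sum; apply: ler_sum.
have innD_ge : k <= set_inner W D by exact: set_inner_ge.
have k0 : 0 <= k by exact: ler0n.
have a_gt0 : 0 < a by lra.
pose p := 4 * (s * K) / a.
have pa : p * a = 4 * (s * K) by rewrite divfK // lt0r_neq0.
have p01 : 0 <= p <= 1.
  apply/andP; split; last by rewrite ler_pdivrMr // mul1r ltW.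
  by rewrite divr_ge0 //; lra.
have /andP[p0 p1] := p01.
pose m := p * a + (1 - p) * k.
pose q := p * set_inner W A + (1 - p) * set_inner W D.
have m_ge : p * a <= m by rewrite lerDl mulr_ge0 // subr_ge0.
have m0 : 0 < m by rewrite (lt_le_trans _ m_ge) // pa; lra.
have mq : m <= q.
  by rewrite /q innA lerD2l ler_wpM2l // subr_ge0.
have q0 : 0 < q by exact: lt_le_trans mq.
(* The signal [m / q] is the one making the constraint on the drawn set tight on average. *)
have theta01 : 0 < m / q <= 1 by rewrite divr_gt0 // ler_pdivrMr // mul1r.
(* The mean size is at most [4 * (s * K) + K + 1], hence at most [6 * (s * K)], and
   [K <= 2 * OPT W]. *)
have m_le : m <= 12 * s * OPT W.
  have : (1 - p) * k <= k by rewrite ler_piMl //; lra.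
  by rewrite /m pa -mulrA; lra.
have [||S [sig [phi [S2 [sigP [phiP [pers le_cost]]]]]]] :=
  @two_set_scheme _ _ _ W1 p (m / q) m q A D p01 theta01 erefl erefl.
- by rewrite divfK // lt0r_neq0.
- rewrite mulrAC ler_pdivlMr //.
  set rA := set_reach W A in reachA *; set rD := set_reach W D in reachD *.
  (* Since [4 * K < a], the overcovering [a - K] exceeds [a / 2]. *)
  have T_ge : n + p * a / 2 <= p * rA + (1 - p) * rD.
    have : p * (n + a / 2) <= p * rA by apply: ler_wpM2l => //; lra.
    have : (1 - p) * n <= (1 - p) * rD by apply: ler_wpM2l => //; lra.
    by lra.
  have T0 : 0 <= n + p * a / 2 by rewrite addr_ge0 ?ler0n // pa; lra.
  have kK : k * k <= 4 * (K * K).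
    have -> : 4 * (K * K) = (2 * K) * (2 * K) by ring.
    by apply: ler_pM => //; lra.
  have le_q : q <= p * a + 4 * (K * K).
    rewrite /q innA lerD2l (le_trans _ kK) // (le_trans _ innD) //.
    by rewrite ler_piMl //; lra.
  have le1 : n * q <= n * (p * a + 4 * (K * K)) by apply: ler_wpM2l => //; lra.
  apply: le_trans le1 _.
  have le2 : p * a * (n + p * a / 2) <= m * (p * rA + (1 - p) * rD).
    apply: ler_pM => //; rewrite pa; lra.
  apply: le_trans le2; rewrite pa -s2.
  (* With [p * a = 4 * (s * K)], the gain [(p * a) ^ 2 / 2] equals [8 * n * K ^ 2] and exceeds the
     loss [4 * n * K ^ 2] due to the edges inside [D]. *)
  have : 0 <= (s * K) * (s * K) by rewrite mulr_ge0; lra.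
  by lra.
by exists S, sig, phi; do 4!split=> //; exact: le_trans m_le.
Qed.

Theorem theorem1p1 :
  forall R : realType,
  (exists C : R, 0 < C /\
    forall (V : finType) (W : V -> V -> R), unit_weight W ->
      exists (S : finType) (sig : S -> R)
             (phi : {ffun 'I_#|V| -> V} -> {ffun V -> S} -> R),
        #|S| = 2%N /\ signal_space sig /\ is_scheme phi /\
        persuasive W sig phi /\
        cost sig phi <= C * Num.sqrt (#|V|%:R) * OPT W)
  /\
  (exists c K : R, 0 < c /\
    forall N : nat, exists (V : finType) (W : V -> V -> R),
      unit_weight W /\ (N <= #|V|)%N /\ OPT W <= K /\
      forall (S : finType) (sig : S -> R)
             (phi : {ffun 'I_#|V| -> V} -> {ffun V -> S} -> R),
        signal_space sig -> is_scheme phi -> persuasive W sig phi ->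
        c * Num.sqrt (#|V|%:R) <= cost sig phi).
Proof.
move=> R; split; first by exists 12; split=> // V W; exact: sqrt_scheme.
(* The cost is at least [r / 6], and the number of vertices [2 + 2 * r ^ 2] has square root at most
   [2 * r]. *)
exists (1 / 12), 2; split; first by rewrite divr_gt0.
move=> N; pose r := maxn 6 N; pose L := (r * r)%N.
have r6 : (6 <= r)%N by rewrite leq_maxl.
have cardV : #|double_star L| = (2 + 2 * L)%N.
  by rewrite card_sum card_prod card_bool card_ord.
exists (double_star L), (@double_star_weight R L).
split; first exact: double_star_unit.
split.
  rewrite cardV (leq_trans (leq_maxr 6 N)) // -/r (@leq_trans L) ?leq_pmulr //.
    exact: leq_trans r6.
  by rewrite mul2n -addnn addnCA leq_addr.
split; first exact: double_star_OPT.
move=> S sig phi sigP phiP pers.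
apply: le_trans (double_star_cost r6 erefl sigP phiP pers).
have r6R : 6 <= r%:R :> R by rewrite ler_nat.
suff : Num.sqrt #|double_star L|%:R <= 2 * r%:R :> R by lra.
rewrite -[leRHS]ger0_norm ?mulr_ge0 ?ler0n // -sqrtr_sqr ler_wsqrtr // cardV.
rewrite natrD natrM natrM exprMn.
have : 6 * 6 <= r%:R * r%:R :> R by apply: ler_pM.
by lra.
Qed.
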